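(* Fix $\theta\in\Theta$. The problem $\sup_{P\in\mathcal{P}}\mathbb{E}_P[h(\theta,\xi)]$ has a finite optimal value, and it is equivalent (i.e. has the same optimal value) to the following conic linear program over positive measures $\mu$ on $(\Xi\times\Xi,\mathcal{F}\times\mathcal{F})$: $$ \begin{array}{cll} \sup_{\mu} & \displaystyle\int_{s\in\Xi} h(\theta,s)\,\mu(ds\times\Xi) & \\ \text{s.t.} & \mu(\Xi\times\Xi^i)=1/m, & i\in[m],\\ & \mu(\Xi\times\Xi^{m+1})=0, & \\ & \displaystyle\sum_{i\in[m]}\int_{s\in\Xi} d(s,\xi^i)\,\mu(ds\times\Xi^i)\le r_0, & \\ & \mu\succeq 0, & \end{array} $$ where $\mu\succeq 0$ means that $\mu$ is a positive measure.
   Context: Setting. $[m]=\{1,\dots,m\}$. $(\Xi,\mathcal{F})$ is a measurable space, where $\Xi\subseteq\mathbb{R}^n$ and $\mathcal{F}$ is a $\sigma$-algebra containing all singletons of $\Xi$. $\mathcal{M}(\Xi,\mathcal{F})$ is the set of all probability distributions on $(\Xi,\mathcal{F})$. $d(\cdot,\cdot)$ is a metric on $\Xi$, measurable with respect to $\mathcal{F}\times\mathcal{F}$. For $P_1,P_2\in\mathcal{M}(\Xi,\mathcal{F})$ the $L_1$-Wasserstein metric is $$\mathcal{W}(P_1,P_2)=\inf_{K\in\mathcal{S}(P_1,P_2)}\int_{\Xi\times\Xi}d(s_1,s_2)\,K(ds_1\times ds_2),$$ where $\mathcal{S}(P_1,P_2)$ is the set of probability measures $K$ on $(\Xi\times\Xi,\mathcal{F}\times\mathcal{F})$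 with $K(A\times\Xi)=P_1(A)$ and $K(\Xi\times A)=P_2(A)$ for all $A\in\mathcal{F}$. The points $\xi^1,\dots,\xi^m\in\Xi$ are observed samples, and $P_0$ is the empirical distribution $P_0(\{\xi^i\})=1/m$, $i\in[m]$. The set $\Xi$ is partitioned as $\Xi=\bigcup_{i=1}^{m+1}\Xi^i$ with $\Xi^i=\{\xi^i\}$ for $i\in[m]$ and $\Xi^{m+1}=\Xi\setminus\bigcup_{i\in[m]}\Xi^i$. For a scalar $r_0$, the ambiguity set is $\mathcal{P}=\{P\in\mathcal{M}(\Xi,\mathcal{F}):\mathcal{W}(P,P_0)\le r_0\}$. Standing assumptions: $r_0>0$; $\Theta\subseteq\mathbb{R}^n$ and $\Xi$ are compact; $h:\Theta\times\Xi\to\mathbb{R}$ is continuous in $\theta$ and bounded on $\Theta\times\Xi$; for every $\theta\in\Theta$ there exists $C(\theta)>0$ with $|h(\theta,s_1)-h(\theta,s_2)|\le C(\theta)\,d(s_1,s_2)$ for all $s_1,s_2\in\Xi$. *)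

(* Defs.v *)
From HB Require Import structures.
From mathcomp Require Import all_boot all_order all_algebra.
From mathcomp Require Import all_classical all_reals all_analysis.

Set Implicit Arguments.
Unset Strict Implicit.
Unset Printing Implicit Defensive.

Import Order.TTheory GRing.Theory Num.Theory.
Import numFieldNormedType.Exports.

Local Open Scope classical_set_scope.
Local Open Scope ring_scope.
Local Open Scope ereal_scope.

(* A measurableType is pointed, but a subset of R^n seen as a type has no
   canonical point; pointed_at x0 is T with the point x0. *)
Definition pointed_at (T : choiceType) (x0 : T) : Type := T.

HB.instance Definition _ (T : choiceType) (x0 : T) :=
  Choice.copy (pointed_at x0) T.
HB.instance Definition _ (T : choiceType) (x0 : T) :=
  isPointed.Build (pointed_at x0) x0.

(* The measurable space (T, F): its measurable sets are <<s F >>, which is F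
   when F is a sigma-algebra (measurable_g_measurableTypeE); x0 plays no
   other role than that of the canonical point. *)
Definition mspace (T : choiceType) (F : set (set T)) (x0 : T) :
    measurableType (@sigma_display (pointed_at x0) F) :=
  g_sigma_algebraType (F : set (set (pointed_at x0))).

Definition is_metric (R : realType) (T : Type) (d : T -> T -> R) :=
  [/\ forall x y, (0 <= d x y)%R,
      forall x y, d x y = 0%R <-> x = y,
      forall x y, d x y = d y x
    & forall x y z, (d x z <= d x y + d y z)%R].

Section wasserstein.
Context {disp : measure_display} {X : measurableType disp} {R : realType}.
Implicit Types (d : X -> X -> R) (P Q : probability X R).

Definition couplings P Q : set (probability (X * X)%type R) :=
  [set K | forall A : set X, measurable A ->
     K (A `*` [set: X]) = P A /\ K ([set: X] `*` A) = Q A].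

Definition wasserstein d P Q : \bar R :=
  ereal_inf [set \int[K]_z (d z.1 z.2)%:E | K in couplings P Q].

Definition ambiguity_set d P0 (r0 : R) : set (probability X R) :=
  [set P | wasserstein d P P0 <= r0%:E].

(* When f is not measurable, 'E_P[f] is the library's (total) integral, i.e. the
   difference of the lower integrals of the positive and negative parts. *)
Definition worst_case d P0 (r0 : R) (f : X -> R) : \bar R :=
  ereal_sup [set 'E_P[f] | P in ambiguity_set d P0 r0].

End wasserstein.

Section conic_program.
Context {disp : measure_display} {X : measurableType disp} {R : realType}.
Variables (m : nat) (xi : 'I_m -> X) (d : X -> X -> R) (r0 : R).
Implicit Type mu : {measure set (X * X)%type -> \bar R}.

(* The measure mu(ds x B) on X. *)
Definition slice mu (B : set X) : set X -> \bar R := fun A => mu (A `*` B).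

Definition atom (i : 'I_m) : set X := [set xi i].
Definition rest : set X := [set: X] `\` \bigcup_i atom i.

Definition lp_feasible : set {measure set (X * X)%type -> \bar R} :=
  [set mu : {measure set (X * X)%type -> \bar R} | [/\ forall i, mu ([set: X] `*` atom i) = (m%:R^-1)%:E,
                mu ([set: X] `*` rest) = 0
              & \sum_(i < m) \int[slice mu (atom i)]_s (d s (xi i))%:E
                  <= r0%:E]].

Definition lp_value (f : X -> R) : \bar R :=
  ereal_sup [set \int[slice mu [set: X]]_s (f s)%:E | mu in lp_feasible].

End conic_program.

(* Main.v *)
(** A feasible measure of the conic program is exactly a coupling, of cost at
    most [r0], of its first marginal with [P0]; this gives one inequality.  The
    infimum defining the Wasserstein distance need not be attained, so for the
    other one a coupling [K] of [P] and [P0] of cost below [r0 + a] is mixed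
    with the diagonal coupling [K0] of [P0] with itself, which costs nothing:
    [r0 / (r0 + a) K + a / (r0 + a) K0] is feasible, and since [h] is bounded
    its objective value is close to [E_P h] when [a] is small.  The function
    [h theta] may fail to be measurable (e.g. when [d] is the discrete metric),
    so this last estimate is made on lower integrals. *)
Require Import Defs.
From HB Require Import structures.
From mathcomp Require Import all_boot all_order all_algebra.
From mathcomp Require Import all_classical all_reals all_analysis.
From mathcomp Require Import measurable_realfun lra.

Set Implicit Arguments.
Unset Strict Implicit.
Unset Printing Implicit Defensive.

Import Order.TTheory GRing.Theory Num.Theory.
Import numFieldNormedType.Exports.

Local Open Scope classical_set_scope.
Local Open Scope ring_scope.

(** * Lower integrals of possibly non-measurable functions *)

Section lower_integral.
Local Open Scope ereal_scope.
Context {disp : measure_display} {T : measurableType disp} {R : realType}.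
Implicit Types (m : {measure set T -> \bar R}) (f : T -> \bar R).
Import HBNNSimple.

(** For nonnegative [f], measurable or not, the integral is a supremum over the simple functions
    below [f]. An upper bound can thus be checked on these, where integration is linear in the
    measure. *)
Lemma integral_le_nnsfun m f c : (forall x, 0 <= f x) ->
  (forall g : {nnsfun T >-> R}, (forall x, (g x)%:E <= f x) ->
     \int[m]_x (g x)%:E <= c) ->
  \int[m]_x f x <= c.
Proof.
move=> f0 fc; rewrite ge0_integralTE//; apply: ge_ereal_sup => _ [g gf <-].
by rewrite -integralT_nnsfun; exact: fc.
Qed.

Lemma nnsfun_le_integral m f (g : {nnsfun T >-> R}) :
  (forall x, 0 <= f x) -> (forall x, (g x)%:E <= f x) ->
  \int[m]_x (g x)%:E <= \int[m]_x f x.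
Proof.
move=> f0 gf; rewrite (ge0_integralTE m f0) integralT_nnsfun.
by apply: ereal_sup_ubound; exists g.
Qed.

Lemma nnsfun_mscale_integral m (k : {nonneg R}) (g : {nnsfun T >-> R}) :
  \int[mscale k m]_x (g x)%:E = k%:num%:E * \int[m]_x (g x)%:E.
Proof.
rewrite ge0_integral_mscale//; first exact/measurable_EFinP.
by move=> x _; rewrite lee_fin.
Qed.

Lemma lower_integral_mscale m (k : {nonneg R}) f : (forall x, 0 <= f x) ->
  \int[mscale k m]_x f x <= k%:num%:E * \int[m]_x f x.
Proof.
move=> f0; apply: integral_le_nnsfun => // g gf.
rewrite nnsfun_mscale_integral lee_wpmul2l ?lee_fin//.
exact: nnsfun_le_integral.
Qed.

(** One simple function below [f] competes in both integrals on the right. *)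
Lemma lower_integral_measure_add m1 m2 f : (forall x, 0 <= f x) ->
  \int[measure_add m1 m2]_x f x <= \int[m1]_x f x + \int[m2]_x f x.
Proof.
move=> f0; apply: integral_le_nnsfun => // g gf.
by rewrite integral_measure_add_nnsfun// leeD// nnsfun_le_integral.
Qed.

(** A simple function below [f] keeps at least its [m1] share under the mixture, since its [m2]
    integral is nonnegative. *)
Lemma mscale_le_lower_integral m1 m2 (k : {nonneg R}) f :
  (0 < k%:num)%R -> (forall x, 0 <= f x) ->
  k%:num%:E * \int[m1]_x f x <= \int[measure_add (mscale k m1) m2]_x f x.
Proof.
move=> k0 f0; rewrite -lee_pdivlMl//; apply: integral_le_nnsfun => // g gf.
rewrite lee_pdivlMl// -nnsfun_mscale_integral.
apply: le_trans (nnsfun_le_integral _ f0 gf).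
rewrite integral_measure_add_nnsfun// leeDl// integral_ge0// => x _.
by rewrite lee_fin.
Qed.

Lemma lower_integral_bound m f (B : R) : m setT = 1 ->
  (forall x, 0 <= f x) -> (forall x, f x <= B%:E) -> \int[m]_x f x <= B%:E.
Proof.
move=> m1 f0 fB; apply: integral_le_nnsfun => // g gf.
rewrite -[B%:E]mule1 -m1 -integral_cst//; apply: ge0_le_integral => //.
- by move=> x _; rewrite lee_fin.
- exact/measurable_EFinP.
- by move=> x _; exact: le_trans (gf x) (fB x).
Qed.

Lemma posneg_bound (f : T -> R) (B : R) : (forall x, `|f x| <= B)%R ->
  (forall x, (EFin \o f)^\+ x <= B%:E) /\ (forall x, (EFin \o f)^\- x <= B%:E).
Proof.
move=> fB; split => x; have := fB x; rewrite ler_norml => /andP[lo hi].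
  by rewrite unlock/= ge_max !lee_fin hi/=; lra.
by rewrite unlock/= ge_max !lee_fin; apply/andP; split; lra.
Qed.

(** Naming the two integrals as reals lets later estimates be settled by real arithmetic. *)
Lemma bounded_integral_parts m (f : T -> R) (B : R) : m setT = 1 ->
  (forall x, `|f x| <= B)%R ->
  exists a b : R, [/\ \int[m]_x (EFin \o f)^\+ x = a%:E,
    \int[m]_x (EFin \o f)^\- x = b%:E, (0 <= a <= B)%R & (0 <= b <= B)%R].
Proof.
move=> m1 /posneg_bound[fp fn].
have part (g : T -> \bar R) : (forall x, 0 <= g x) -> (forall x, g x <= B%:E) ->
    exists2 a : R, \int[m]_x g x = a%:E & (0 <= a <= B)%R.
  move=> g0 gB.
  have lb : 0 <= \int[m]_x g x by apply: integral_ge0.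
  have ub := lower_integral_bound m1 g0 gB.
  have fi : \int[m]_x g x \is a fin_num.
    by rewrite ge0_fin_numE// (le_lt_trans ub)// ltry.
  exists (fine (\int[m]_x g x)); first by rewrite fineK.
  by rewrite -!lee_fin fineK// lb ub.
have [a ea aB] := part _ (funepos_ge0 _) fp.
have [b eb bB] := part _ (funeneg_ge0 _) fn.
by exists a, b.
Qed.

Lemma integral_bounded m (f : T -> R) (B : R) : m setT = 1 ->
  (forall x, `|f x| <= B)%R -> - B%:E <= \int[m]_x (f x)%:E <= B%:E.
Proof.
move=> m1 fB; have [a [b [ea eb aB bB]]] := bounded_integral_parts m1 fB.
rewrite integralE ea eb -EFinB !lee_fin.
by apply/andP; split; lra.
Qed.

(** Passing to the mixture loses at most [l * B] on the positive part, as a share [l] of [m1] is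
    dropped, and at most [l * B] on the negative part, through the share [l] of [m2]. *)
Lemma mixture_integral_ge m1 m2 (f : T -> R) (B : R) (k l : {nonneg R}) :
  m1 setT = 1 -> m2 setT = 1 -> (k%:num + l%:num = 1)%R -> (0 < k%:num)%R ->
  (forall x, `|f x| <= B)%R ->
  \int[m1]_x (f x)%:E <=
  \int[measure_add (mscale k m1) (mscale l m2)]_x (f x)%:E
    + (2 * l%:num * B)%:E.
Proof.
move=> m11 m21 kl k0 fB.
have m1T : measure_add (mscale k m1) (mscale l m2) setT = 1.
  by rewrite measure_addE/= /mscale/= m11 m21 !mule1 -EFinD kl.
have [a1 [b1 [ea1 eb1 /andP[? ?] /andP[? ?]]]] := bounded_integral_parts m11 fB.
have [a2 [b2 [ea2 eb2 /andP[? ?] /andP[? ?]]]] := bounded_integral_parts m21 fB.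
have [a [b [ea eb _ _]]] := bounded_integral_parts m1T fB.
have pos : (k%:num * a1 <= a)%R.
  rewrite -lee_fin EFinM -ea1 -ea; exact: mscale_le_lower_integral.
have neg : (b <= k%:num * b1 + l%:num * b2)%R.
  rewrite -lee_fin EFinD !EFinM -eb1 -eb2 -eb.
  apply: le_trans (lower_integral_measure_add _ _ _) _ => //.
  by rewrite leeD// lower_integral_mscale.
rewrite integralE [X in _ <= X + _]integralE ea1 eb1 ea eb -!EFinB -EFinD lee_fin.
have l0 : (0 <= l%:num)%R by [].
have ek : k%:num = (1 - l%:num)%R by lra.
move: pos neg; rewrite ek => pos neg.
have : (l%:num * a1 <= l%:num * B)%R by rewrite ler_wpM2l.
have : (l%:num * b2 <= l%:num * B)%R by rewrite ler_wpM2l.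
have : (0 <= l%:num * b1)%R by rewrite mulr_ge0.
lra.
Qed.

End lower_integral.

(** * Probabilities obtained by normalisation and by pushforward *)

Lemma probability_of_mass1 d (T : measurableType d) (R : realType)
    (m : {measure set T -> \bar R}) :
  m setT = 1%E -> exists P : probability T R, (P : set T -> \bar R) = m.
Proof.
(* The Dirac measure is only the fallback for mass zero or infinity; here the mass is 1, so
   normalising changes nothing. *)
move=> mT; exists (mnormalize m (\d_(point : T))).
by apply/funext => A; rewrite /= /mnormalize mT/= onee_eq0/= invr1 mule1.
Qed.

Lemma probability_pushforward d1 d2 (T1 : measurableType d1)
    (T2 : measurableType d2) (R : realType) (P : probability T1 R)
    (f : T1 -> T2) : measurable_fun setT f ->
  exists Q : probability T2 R, (Q : set T2 -> \bar R) = pushforward P f.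
Proof.
move=> mf; pose pf := isMeasurableFun.Build _ _ _ _ _ mf.
pose X : {mfun T1 >-> T2} := HB.pack f pf.
by exists (distribution P X).
Qed.

(** * Slices of a measure on the product *)

Section coupling.
Local Open Scope ereal_scope.
Context {disp : measure_display} {X : measurableType disp} {R : realType}.
Implicit Types (mu : {measure set (X * X)%type -> \bar R}).

Lemma slice_setTE mu : slice mu setT = pushforward mu fst.
Proof.
apply/funext => A; rewrite /slice /pushforward; congr (mu _).
by apply/seteqP; split => [x []|x Ax].
Qed.

Lemma integral_mrestr d (T : measurableType d) (m : {measure set T -> \bar R})
    (D : set T) (mD : measurable D) (f : T -> \bar R) :
  measurable_fun setT f -> (forall x, 0 <= f x) ->
  \int[mrestr m mD]_x f x = \int[m]_(x in D) f x.
Proof.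
move=> mf f0.
rewrite (@ge0_negligible_integral _ _ _ (mrestr m mD) _ (~` D))//; last 2 first.
- exact: measurableC.
- by rewrite /= /mrestr setICl measure0.
rewrite setTD setCK; apply: eq_measure_integral => A mA AD.
by rewrite /= /mrestr; congr (m _); apply/setIidPl.
Qed.

(** A slice is the pushforward along [fst] of [mu] restricted to the strip over [B]; the rest is
    change of variables. *)
Lemma integral_slice mu (B : set X) (g : X -> \bar R) : measurable B ->
  measurable_fun setT g -> (forall x, 0 <= g x) ->
  \int[slice mu B]_s g s = \int[mu]_(z in [set: X] `*` B) g z.1.
Proof.
move=> mB mg g0.
have mD : measurable ([set: X] `*` B) by exact: measurableX.
have -> : slice mu B = pushforward (mrestr mu mD) fst.
  apply/funext => A; rewrite /slice /pushforward /mrestr; congr (mu _).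
  by apply/seteqP; split => [x []|x [? []]].
rewrite ge0_integral_pushforward// integral_mrestr//; last by move=> z; exact: g0.
exact: measurableT_comp.
Qed.

(** * Measures carried by the strips over the atoms *)

Section atoms.
Variables (m : nat) (xi : 'I_m -> X).
Hypotheses (m_gt0 : (0 < m)%N) (xi_inj : injective xi).
Hypothesis m1 : forall x : X, measurable [set x].

Lemma measurable_rest : measurable (rest xi).
Proof.
apply: measurableD => //; apply: fin_bigcup_measurable => [|i _].
  exact: finite_finset.
exact: m1.
Qed.

Lemma measurable_atom i : measurable (atom xi i).
Proof. exact: m1. Qed.
#[local] Hint Resolve measurable_atom measurable_rest : core.

(** Up to a null set the product is the disjoint union of the strips over the atoms, and on each
    strip the second coordinate is constant. With [d] as integrand, this identifies the cost
    constraint with the transport cost. *)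
Lemma integral_atoms mu (g : X * X -> \bar R) :
  mu ([set: X] `*` rest xi) = 0 ->
  measurable_fun setT g -> (forall z, 0 <= g z) ->
  \int[mu]_z g z = \sum_(i < m) \int[slice mu (atom xi i)]_s g (s, xi i).
Proof.
move=> mu0 mg g0.
have mA i : measurable ([set: X] `*` atom xi i) by exact: measurableX.
rewrite (@ge0_negligible_integral _ _ _ mu _ ([set: X] `*` rest xi))//; last first.
  exact: measurableX.
have -> : setT `\` ([set: X] `*` rest xi) =
    \big[setU/set0]_(i <- index_enum 'I_m) ([set: X] `*` atom xi i).
  rewrite -bigcup_seq; apply/seteqP; split => [[x y]|[x y] [i _ [_ /= ->]]].
    move=> [_ /=]; rewrite /rest /= => nr.
    have [[i _ yi]|ni] := pselect ((\bigcup_i atom xi i) y).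
      by exists i => //=; rewrite mem_index_enum.
    by exfalso; apply: nr.
  by split => // -[_ [_]]; apply; exists i.
rewrite ge0_integral_bigsetU//.
- apply: eq_bigr => i _; rewrite integral_slice//; last first.
    exact: measurable_fun_pair1.
  by apply: eq_integral => -[x y]; rewrite inE => -[_ /= ->].
- exact: index_enum_uniq.
- apply/trivIsetP => i j _ _ ij; apply/seteqP; split => // -[x y].
  move=> [[_ /= yi] [_ /= yj]].
  by move: ij; rewrite (xi_inj (etrans (esym yi) yj)) eqxx.
- exact: measurable_funTS.
Qed.

Local Notation invm := (m%:R^-1 : R)%R.

Lemma sum_invm : \sum_(i < m) invm%:E = 1.
Proof.
rewrite sumEFin sumr_const card_ord -[(_^-1 *+ _)%R]mulr_natl divff//.
by rewrite pnatr_eq0 -lt0n.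
Qed.

(** This is [integral_atoms] for an indicator. The right side does not involve [mu], so all measures
    meeting these constraints share one second marginal. *)
Lemma atoms_snd_marginal mu (A : set X) :
  (forall i, mu ([set: X] `*` atom xi i) = invm%:E) ->
  mu ([set: X] `*` rest xi) = 0 -> measurable A ->
  mu ([set: X] `*` A) = \sum_(i < m) (\1_A (xi i))%:E * invm%:E.
Proof.
move=> mui mur mA.
have mTA : measurable ([set: X] `*` A) by exact: measurableX.
rewrite -[X in mu X]setIT -integral_indic// integral_atoms//; last first.
  exact/measurable_EFinP.
apply: eq_bigr => i _.
rewrite (_ : (fun s => _) = cst (\1_A (xi i))%:E).
  rewrite integral_slice// -(mui i); apply: integral_cst.
  exact: measurableX.
by apply/funext => s; rewrite indicE in_setX in_setT -indicE.
Qed.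

Lemma atoms_mass1 mu : (forall i, mu ([set: X] `*` atom xi i) = invm%:E) ->
  mu ([set: X] `*` rest xi) = 0 -> mu setT = 1.
Proof.
move=> mui mur; rewrite -setXTT atoms_snd_marginal//.
under eq_bigr do rewrite indicT mul1e.
exact: sum_invm.
Qed.

(** * Couplings with the empirical distribution and feasible measures *)

Variables (d : X -> X -> R) (r0 : R) (P0 : probability X R).
Hypotheses (d_ge0 : forall x y, (0 <= d x y)%R) (dxx : forall x, d x x = 0%R).
Hypothesis md : measurable_fun [set: X * X] (fun z => d z.1 z.2).
Hypothesis P0_atom : forall i, P0 (atom xi i) = invm%:E.
Hypothesis r0_gt0 : (0 < r0)%R.

Lemma empirical_rest : P0 (rest xi) = 0.
Proof.
have fT : finite_set [set: 'I_m] by exact: finite_finset.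
rewrite /rest setTD probability_setC; last exact: fin_bigcup_measurable.
rewrite measure_fin_bigcup//; last first.
  apply/trivIsetP => i j _ _ ij; apply/seteqP; split => // x [xi_ xj].
  by move: ij; rewrite (xi_inj (etrans (esym xi_) xj)) eqxx.
rewrite (_ : [set: 'I_m] = [set` index_enum 'I_m]); last first.
  by apply/seteqP; split => // i _ /=; exact: mem_index_enum.
rewrite -fsbig_seq ?index_enum_uniq//.
rewrite (eq_bigr (fun=> invm%:E)); last first.
  by move=> i _; exact: P0_atom.
by rewrite sum_invm subee.
Qed.

(** Pushing [P0] along the diagonal gives a coupling that serves to identify second marginals, to
    repair the cost of near-optimal couplings, and to place [P0] in the ambiguity set. *)
Lemma diagonal_coupling : exists K0 : probability (X * X)%type R,
  [/\ couplings P0 P0 K0,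
      (forall i, K0 ([set: X] `*` atom xi i) = invm%:E),
      K0 ([set: X] `*` rest xi) = 0
    & \int[K0]_z (d z.1 z.2)%:E = 0].
Proof.
pose diag := fun x : X => (x, x).
have mdiag : measurable_fun setT diag by exact: measurable_fun_pair.
have [K0 K0E] := probability_pushforward P0 mdiag.
have K0X A B : K0 (A `*` B) = P0 (A `&` B) by rewrite K0E.
exists K0; split.
- by move=> A mA; rewrite !K0X setIT setTI.
- by move=> i; rewrite K0X setTI P0_atom.
- by rewrite K0X setTI empirical_rest.
rewrite K0E ge0_integral_pushforward//.
- by apply: integral0_eq => x _ /=; rewrite dxx.
- exact/measurable_EFinP.
- by move=> z _; rewrite lee_fin.
Qed.

Lemma feasible_marginal mu : lp_feasible xi d r0 mu ->
  exists2 P : probability X R, ambiguity_set d P0 r0 P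
    & (P : set X -> \bar R) = slice mu setT.
Proof.
move=> [mui mur cost].
have [K KE] := probability_of_mass1 (atoms_mass1 mui mur).
have [K0 [K0P K0i K0r _]] := diagonal_coupling.
have [P PE] := probability_pushforward K measurable_fst.
have PKE : (P : set X -> \bar R) = slice mu setT by rewrite slice_setTE PE KE.
exists P => //; apply: le_trans cost; apply: ereal_inf_lbound; exists K.
  move=> A mA; split; first by rewrite PKE KE.
  (* [P0 A] is read as a second marginal of [K0], so both sides become the same sum over atoms. *)
  rewrite -(K0P A mA).2 KE.
  by rewrite atoms_snd_marginal// [RHS]atoms_snd_marginal.
rewrite KE integral_atoms//; first exact/measurable_EFinP.
by move=> z; rewrite lee_fin.
Qed.

Lemma mixture_feasible (P : probability X R) (K K0 : probability (X * X)%type R)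
    (k l : {nonneg R}) :
  couplings P P0 K -> couplings P0 P0 K0 -> (k%:num + l%:num = 1)%R ->
  k%:num%:E * \int[K]_z (d z.1 z.2)%:E <= r0%:E ->
  \int[K0]_z (d z.1 z.2)%:E = 0 ->
  lp_feasible xi d r0 (measure_add (mscale k K) (mscale l K0)).
Proof.
move=> KP K0P kl cost cost0.
have mur : measure_add (mscale k K) (mscale l K0) ([set: X] `*` rest xi) = 0.
  rewrite measure_addE/= /mscale/= (KP _ _).2// (K0P _ _).2//.
  by rewrite empirical_rest !mule0 adde0.
have dge0 z : 0 <= (d z.1 z.2)%:E by rewrite lee_fin.
have mdE : measurable_fun [set: X * X] (fun z => (d z.1 z.2)%:E).
  exact/measurable_EFinP.
split => //.
- move=> i; rewrite [LHS]measure_addE/= /mscale/= (KP _ _).2// (K0P _ _).2//.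
  by rewrite P0_atom -ge0_muleDl// -EFinD kl mul1e.
- rewrite -(integral_atoms mur mdE)// ge0_integral_measure_add//.
  by rewrite !ge0_integral_mscale// cost0 mule0 adde0.
Qed.

Lemma expectation_le_lp (P : probability X R) (f : X -> R) (B : R) :
  (forall x, `|f x| <= B)%R -> ambiguity_set d P0 r0 P ->
  'E_P[f] <= lp_value xi d r0 f.
Proof.
move=> fB PW; rewrite unlock.
have B0 : (0 <= B)%R by apply: le_trans (fB point).
apply/lee_addgt0Pr => e e0.
have B1 : (0 < 2 * B + 1)%R by lra.
(* The weight of [K0] will be [a / (r0 + a)], at most [a / r0 = e / (2 * B + 1)], so the mixture
   error is at most [e]. The [+ 1] keeps the denominator positive when [B = 0]. *)
pose a := (r0 * (e / (2 * B + 1)))%R.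
have a0 : (0 < a)%R by rewrite mulr_gt0// divr_gt0.
have ra0 : (0 < r0 + a)%R by rewrite addr_gt0.
have : wasserstein d P P0 < (r0 + a)%:E.
  by rewrite (le_lt_trans PW)// lte_fin ltrDl.
move=> /ereal_inf_lt[_ [K KP <-] Kcost].
have [K0 [K0P _ _ K0cost]] := diagonal_coupling.
have k0 : (0 < r0 / (r0 + a))%R by rewrite divr_gt0.
have l0 : (0 <= a / (r0 + a))%R by rewrite divr_ge0// ltW.
pose k := NngNum (ltW k0); pose l := NngNum l0.
have kl : (k%:num + l%:num = 1)%R by rewrite /= -mulrDl divff// gt_eqF.
have feas : lp_feasible xi d r0 (measure_add (mscale k K) (mscale l K0)).
  apply: (mixture_feasible KP K0P) => //.
  rewrite -lee_pdivlMl// (le_trans (ltW Kcost))//= -EFinM lee_fin.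
  by rewrite invf_div divfK ?gt_eqF.
have [P' _ P'E] := feasible_marginal feas.
apply: (@le_trans _ _ (\int[P']_x (f x)%:E + (2 * l%:num * B)%:E)).
  apply: (le_trans (mixture_integral_ge (probability_setT P)
    (probability_setT P0) kl k0 fB)).
  (* The two integrals agree: [P'] is the first marginal of the mixture, namely [k P + l P0]. *)
  rewrite leeD2r// le_eqVlt; apply/orP; left; apply/eqP.
  apply: eq_measure_integral => A mA _.
  transitivity (slice (measure_add (mscale k K) (mscale l K0)) setT A).
    rewrite /slice [LHS]measure_addE [RHS]measure_addE/= /mscale/=.
    by rewrite (KP _ mA).1 (K0P _ mA).1.
  by rewrite -P'E.
apply: leeD.
  apply: ereal_sup_ubound; exists (measure_add (mscale k K) (mscale l K0)) => //.
  by rewrite -P'E.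
rewrite lee_fin /=.
have : (a / (r0 + a) <= e / (2 * B + 1))%R.
  by rewrite ler_pdivrMr// mulrDr [(_ * r0)%R]mulrC lerDl mulr_ge0 ?divr_ge0 ?ltW.
set t := (a / _)%R => te.
have : (t * (2 * B) <= e / (2 * B + 1) * (2 * B))%R.
  by rewrite ler_wpM2r// mulr_ge0.
have : (e / (2 * B + 1) * (2 * B) <= e)%R.
  by rewrite mulrAC ler_pdivrMr//; nra.
lra.
Qed.

Lemma worst_case_eq_lp_value (f : X -> R) (B : R) :
  (forall x, `|f x| <= B)%R ->
  worst_case d P0 r0 f \is a fin_num /\
  worst_case d P0 r0 f = lp_value xi d r0 f.
Proof.
move=> fB.
have bound P : - B%:E <= 'E_P[f] <= B%:E.
  by rewrite unlock; exact: integral_bounded (probability_setT P) fB.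
(* Since [P0] is admissible, the supremum is over a nonempty set and is at least [- B]. *)
have P0W : ambiguity_set d P0 r0 P0.
  have [K0 [K0P _ _ K0cost]] := diagonal_coupling.
  apply: (@le_trans _ _ 0); last by rewrite lee_fin ltW.
  by rewrite -[leRHS]K0cost; apply: ereal_inf_lbound; exists K0.
split.
  rewrite fin_numE; apply/andP; split.
    rewrite gt_eqF// (@lt_le_trans _ _ (- B%:E)) ?ltNyr//.
    have /andP[lo _] := bound P0; apply: le_trans lo _.
    by apply: ereal_sup_ubound; exists P0.
  rewrite lt_eqF// (@le_lt_trans _ _ B%:E) ?ltry//.
  by apply: ge_ereal_sup => _ [P _ <-]; have /andP[] := bound P.
apply/eqP; rewrite eq_le; apply/andP; split; apply: ge_ereal_sup.
  by move=> _ [P PW <-]; exact: expectation_le_lp fB PW.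
move=> _ [mu feas <-]; have [P PW <-] := feasible_marginal feas.
by apply: ereal_sup_ubound; exists P => //; rewrite unlock.
Qed.

End atoms.

End coupling.

Theorem theorem3p6 (R : realType) (n m : nat) (m_gt0 : (0 < m)%N)
    (Theta Xi : set 'rV[R]_n) (F : set (set Xi)) (xi : 'I_m -> Xi)
    (d : Xi -> Xi -> R) (r0 : R) (h : 'rV[R]_n -> Xi -> R) :
  let X := mspace F (xi (Ordinal m_gt0)) in
  forall P0 : probability X R,
  sigma_algebra [set: Xi] F ->
  (forall x : Xi, F [set x]) ->
  is_metric d ->
  measurable_fun [set: X * X] (fun z : X * X => d z.1 z.2) ->
  injective xi ->
  (forall i : 'I_m, P0 [set xi i] = (m%:R^-1)%:E) ->
  0 < r0 ->
  compact Theta ->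
  compact Xi ->
  (forall s : Xi, {within Theta, continuous (h ^~ s)}) ->
  (exists B : R, forall theta (s : Xi), Theta theta -> `|h theta s| <= B) ->
  (forall theta, Theta theta -> exists C : R, 0 < C /\
     forall s1 s2 : Xi, `|h theta s1 - h theta s2| <= C * d s1 s2) ->
  forall theta, Theta theta ->
    worst_case (X := X) d P0 r0 (h theta) \is a fin_num /\
    worst_case (X := X) d P0 r0 (h theta) =
      lp_value (X := X) xi d r0 (h theta).
Proof.
move=> X P0 Fsigma F1 [d0 dxy _ _] md xi_inj P0xi r0_gt0 _ _ _ [B hB] _ theta Ttheta.
have m1 (x : X) : measurable [set x] by exact: sub_sigma_algebra (F1 x).
have dxx (x : X) : d x x = 0 by exact/dxy.
exact: (worst_case_eq_lp_value (X := X) m_gt0 xi_inj m1 d0 dxx md P0xi r0_gt0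
  (fun x => hB theta x Ttheta)).
Qed.
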